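(* Let $n\ge1$, $q=(q_1,\dots,q_n)\in(0,1)^n$ and $z\in\mathcal W^n$. Let $(\mathfrak X(t);t\in\mathbb Z_+)$ be the discrete-time process on the set $\mathbb K_n$ of integer Gelfand-Tsetlin patterns with the geometric-jump blocking-and-pushing dynamics described in the context. If $\mathfrak X(0)$ has distribution $M_z(\cdot)$, then the bottom row $(\mathfrak X^n(t);t\in\mathbb Z_+)$ is distributed as an $n$-dimensional Markov process in $\mathcal W^n$, beginning at $z$, with transition kernel $$p(x,x')=\prod_{i=1}^n(1-q_i)\,\frac{S_{x'}(q)}{S_x(q)}\,\mathbf 1_{[x\prec x']},\qquad x,x'\in\mathcal W^n.$$
   Context: $\mathbb Z_+=\{0,1,2,\dots\}$; $\mathcal W^n=\{z\in\mathbb Z^n: z_1\le z_2\le\dots\le z_n\}$. For $x,x'\in\mathbb R^n$, $x\prec x'$ means $x_1\le x_1'\le x_2\le\dots\le x'_{n-1}\le x_n\le x'_n$. Gelfand-Tsetlin patterns: $\mathbb K_n=\{(x^1,\dots,x^n)\in\mathbb Z^1\times\mathbb Z^2\times\dots\times\mathbb Z^n: x^{k+1}_i\le x^k_i\le x^{k+1}_{i+1},\ 1\le i\le k<n\}$, and $\mathbb K_n(z)=\{x\in\mathbb K_n:x^n=z\}$. Weights: $|z|=\sum_{i=1}^d z_i$ for $z\in\mathbb R^d$, and $|x^0|=0$. For $x\in\mathbb K_n$, $w^q(x)=\prod_{i=1}^n q_i^{|x^i|-|x^{i-1}|}$. The Schur function is $S_z(q)=\sum_{x\in\mathbb K_n(z)}w^q(x)$,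 and $M_z(x)=w^q(x)/S_z(q)$, $x\in\mathbb K_n(z)$, is a probability mass function on $\mathbb K_n(z)$. Dynamics of $\mathfrak X$: let $\xi^k_j(t)$, $1\le j\le k\le n$, $t\ge1$, be independent random variables, independent of $\mathfrak X(0)$, with $\mathbb P(\xi^k_j(t)=m)=(1-q_k)q_k^m$, $m=0,1,2,\dots$. Given $\mathfrak X(t)$, the rows of $\mathfrak X(t+1)$ are determined successively, from the top row down. Top particle: $\mathfrak X^1_1(t+1)=\mathfrak X^1_1(t)+\xi^1_1(t+1)$. For $k>1$, once row $k-1$ has been updated: - (pushing) for $2\le j\le k$ put $\tilde{\mathfrak X}^k_j(t)=\max(\mathfrak X^k_j(t),\mathfrak X^{k-1}_{j-1}(t+1))$, and $\tilde{\mathfrak X}^k_1(t)=\mathfrak X^k_1(t)$; - (jump and blocking) for $1\le j<k$, $\mathfrak X^k_j(t+1)=\min(\tilde{\mathfrak X}^k_j(t)+\xi^k_j(t+1),\ \mathfrak X^{k-1}_j(t))$, and $\mathfrak X^k_k(t+1)=\tilde{\mathfrak X}^k_k(t)+\xi^k_k(t+1)$. *)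

(* Defs.v *)
From HB Require Import structures.
From mathcomp Require Export all_boot all_order all_algebra.
From mathcomp Require Export finmap.
From mathcomp Require Export all_classical all_reals all_analysis.

Set Implicit Arguments.
Unset Strict Implicit.
Unset Printing Implicit Defensive.

Import Order.TTheory GRing.Theory Num.Theory.

Local Open Scope classical_set_scope.
Local Open Scope ring_scope.

Notation zvec n := {ffun 'I_n -> int}.

(* Row k of an array has k entries. Row 0 is included: it is the unique empty
   vector, so that |x^0| = 0 holds by definition and row 1 needs no special
   treatment below. *)
Notation gt_array n := {dffun forall k : 'I_n.+1, zvec k}.

Definition zvec_size (n : nat) (z : zvec n) : int := \sum_(i < n) z i.

(* The i-th pair of consecutive rows, i = 0, ..., n - 1: [urow x i] is row i
   and [lrow x i], just below it, is row i + 1. *)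
Definition urow (n : nat) (x : gt_array n) (i : 'I_n) : zvec i :=
  x (widen_ord (leqnSn n) i).

Definition lrow (n : nat) (x : gt_array n) (i : 'I_n) : zvec i.+1 :=
  x (lift ord0 i).

Definition bottom_row (n : nat) (x : gt_array n) : zvec n := x ord_max.

(* [widen_ord _ j] has the same value as j, [lift ord0 j] has value j + 1. *)
Definition gt_pattern (n : nat) : set (gt_array n) :=
  [set x | forall (i : 'I_n) (j : 'I_i),
     lrow x i (widen_ord (leqnSn i) j) <= urow x i j <= lrow x i (lift ord0 j)].

Definition gt_pattern_with (n : nat) (z : zvec n) : set (gt_array n) :=
  [set x | gt_pattern x /\ bottom_row x = z].

Definition weyl_chamber (n : nat) : set (zvec n) :=
  [set z | forall i j : 'I_n, j = i.+1 :> nat -> z i <= z j].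

Definition prec (n : nat) (x x' : zvec n) : bool :=
  [forall i, x i <= x' i] &&
  [forall i : 'I_n, forall j : 'I_n, (j == i.+1 :> nat) ==> (x' i <= x j)].

Section Weights.
Variables (R : realType) (n : nat) (q : 'I_n -> R).

Definition gt_weight (x : gt_array n) : R :=
  \prod_(i < n) q i ^ (zvec_size (lrow x i) - zvec_size (urow x i)).

(* [gt_pattern_with z] is a finite set, so this is a genuine sum. *)
Definition schur (z : zvec n) : R :=
  \sum_(x \in gt_pattern_with z) gt_weight x.

Definition gt_law (z : zvec n) (x : gt_array n) : R :=
  if x \in gt_pattern_with z then gt_weight x / schur z else 0.

Definition schur_kernel (x x' : zvec n) : R :=
  (\prod_(i < n) (1 - q i)) * (schur x' / schur x) * (prec x x')%:R.

End Weights.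

(* New position of particle j (counted from 0) of a row of i + 1 particles:
   [row] is that row at time t, [up] and [up'] the row above it at times t and
   t + 1, and m the attempted jump. [unlift ord0 j] is None if j = 0 and
   otherwise the index j - 1 in the row above; [unlift ord_max j] is None if
   j is the last index and otherwise the index j in the row above. *)
Definition pushed (i : nat) (row : zvec i.+1) (up' : zvec i)
    (j : 'I_i.+1) : int :=
  if unlift ord0 j is Some j' then Num.max (row j) (up' j') else row j.

Definition moved (i : nat) (row : zvec i.+1) (up up' : zvec i)
    (j : 'I_i.+1) (m : nat) : int :=
  let y := pushed row up' j + m%:Z in
  if unlift ord_max j is Some j' then Num.min y (up j') else y.

Section Probability.
Context {d : measure_display} {T : measurableType d} {R : realType}.
Variable P : probability T R.

(* Random variables below take values in countable sets, endowed with the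
   discrete sigma-algebra. *)
Definition sigma_rv (S : Type) (Y : T -> S) : set (set T) :=
  preimage_set_system setT Y discrete_measurable.

Definition discrete_rv (S : Type) (Y : T -> S) : Prop :=
  sigma_rv Y `<=` measurable.

Definition mutually_independent (I : choiceType) (F : I -> set (set T)) : Prop :=
  forall (J : {fset I}) (A : I -> set T), (forall i, i \in J -> F i (A i)) ->
    P (\bigcap_(i in [set` J]) A i) = (\prod_(i <- J) P (A i))%E.

Definition stochastic_kernel (S : choiceType) (E : set S) (p : S -> S -> R) :
    Prop :=
  (forall x y, E x -> E y -> 0 <= p x y) /\
  (forall x, E x -> (\esum_(y in E) (p x y)%:E = 1)%E).

(* The last clause is the Markov property in product form, which also makes
   sense for histories of probability 0. *)
Definition markov_chain (S : choiceType) (E : set S) (z : S) (p : S -> S -> R)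
    (Y : nat -> T -> S) : Prop :=
  [/\ stochastic_kernel E p,
      forall t, discrete_rv (Y t),
      forall t w, E (Y t w),
      P [set w | Y 0%N w = z] = 1%E &
      forall (t : nat) (h : nat -> S) (y : S),
        (forall s, (s <= t)%N -> E (h s)) -> E y ->
        P [set w | (forall s, (s <= t)%N -> Y s w = h s) /\ Y t.+1 w = y] =
        (P [set w | forall s, (s <= t)%N -> Y s w = h s] *
           (p (h t) y)%:E)%E].

Variable n : nat.

(* [xi k j t] is the attempted jump, at time t >= 1, of particle j + 1 of
   row k + 1; xi k j 0 is never used. *)
Definition geometric_jumps (q : 'I_n -> R)
    (xi : forall k : 'I_n, 'I_k.+1 -> nat -> T -> nat) : Prop :=
  forall (k : 'I_n) (j : 'I_k.+1) (t m : nat), (0 < t)%N ->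
    discrete_rv (xi k j t) /\
    P [set w | xi k j t w = m] = ((1 - q k) * q k ^+ m)%:E.

Definition independent_inputs (X0 : T -> gt_array n)
    (xi : forall k : 'I_n, 'I_k.+1 -> nat -> T -> nat) : Prop :=
  mutually_independent
    (fun a : option (nat * {k : 'I_n & 'I_k.+1}) =>
       match a with
       | None => sigma_rv X0
       | Some (t, existT k j) => sigma_rv (xi k j t.+1)
       end).

Definition gt_dynamics (xi : forall k : 'I_n, 'I_k.+1 -> nat -> T -> nat)
    (X : nat -> T -> gt_array n) : Prop :=
  forall (t : nat) (w : T) (k : 'I_n) (j : 'I_k.+1),
    lrow (X t.+1 w) k j =
    moved (lrow (X t w) k) (urow (X t w) k) (urow (X t.+1 w) k) j
      (xi k j t.+1 w).

End Probability.

(* Main.v *)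
(* A jump of a blocked particle contributes a law supported between its pushed
   position a_j = max(z_j, v_(j-1)) and its blocking position u_j; here z, u are
   rows k, k-1 of the pattern x at time t and v is row k-1 of the pattern y at
   time t + 1. With the Schur weight q_k^(-|u|), the sum over u of the law of
   row k factorizes over j and every factor telescopes, because the constraints
   on u_j left by z and v are a_j <= u_j <= b_j = min(z_(j+1), v_j). As
   a_(j+1) + b_j = z_(j+1) + v_j, the powers of q_k recombine into the weight of
   row k of y. Induction on the number of rows gives the intertwining
   M_z Q = p(z, .) M, where Q is the transition kernel of the patterns.
   Consequently, given the bottom rows up to time t, the pattern at time t has
   law M of its bottom row, which is the Markov property of the bottom row.
   That p is stochastic follows from the intertwining and from Q being so. *)
Require Import Defs.
From mathcomp Require Import ring lra zify.

Set Implicit Arguments.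
Unset Strict Implicit.
Unset Printing Implicit Defensive.

Import Order.TTheory GRing.Theory Num.Theory.

Local Open Scope classical_set_scope.
Local Open Scope ring_scope.

(** * Arrays built one row at a time *)

Definition interlace (n : nat) (u : zvec n) (r : zvec n.+1) : Prop :=
  forall j : 'I_n, r (widen_ord (leqnSn n) j) <= u j <= r (lift ord0 j).

(** Access by natural numbers, with value 0 outside the triangle, avoids casts between the ordinal
    types of arrays with different numbers of rows. *)
Definition entry (n : nat) (x : gt_array n) (k j : nat) : int :=
  if insub k is Some k' then
    if insub j is Some j' then (x : gt_array n) k' j' else 0
  else 0.

(** Inverse to the pair [drop_row], [bottom_row]; all inductions on the number of rows go through
    this decomposition. The final 0 is never reached, since [k] is then n + 1. *)
Definition add_row (n : nat) (x : gt_array n) (r : zvec n.+1) : gt_array n.+1 :=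
  [ffun k : 'I_n.+2 => [ffun j : 'I_k =>
     if (k <= n)%N then entry x k j
     else if insub (j : nat) is Some j' then r j' else 0]].

Definition drop_row (n : nat) (x : gt_array n.+1) : gt_array n :=
  [ffun k : 'I_n.+1 => x (widen_ord (leqnSn n.+1) k)].

Lemma row_irr (n : nat) (x : gt_array n) (k : nat) (p p' : (k < n.+1)%N) :
  x (Ordinal p) = x (Ordinal p').
Proof. by rewrite (bool_irrelevance p p'). Qed.

Lemma entryE (n : nat) (x : gt_array n) (k : 'I_n.+1) (j : 'I_k) :
  entry x k j = x k j.
Proof. by rewrite /entry valK /= valK. Qed.

Lemma ord_last_ind (n : nat) (Q : 'I_n.+1 -> Prop) :
  (forall k : 'I_n, Q (widen_ord (leqnSn n) k)) -> Q ord_max -> forall k, Q k.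
Proof.
move=> Qw Qm k; have [kn|] := ltnP k n.
  by have := Qw (Ordinal kn); congr Q; apply: val_inj.
move=> nk; suff -> : k = ord_max by [].
by apply: val_inj; apply/eqP; rewrite eqn_leq nk -ltnS ltn_ord.
Qed.

Section AddRow.
Variables (n : nat) (x : gt_array n) (r : zvec n.+1).

Lemma add_row_widen (k : 'I_n.+1) (p : (k < n.+2)%N) :
  add_row x r (Ordinal p) = x k.
Proof.
by apply/ffunP => j; rewrite !ffunE /= -ltnS ltn_ord entryE.
Qed.

Lemma bottom_add_row : bottom_row (add_row x r) = r.
Proof.
apply/ffunP => j; rewrite /bottom_row !ffunE /= ltnn.
by rewrite (valK j).
Qed.

Lemma urow_add_row (k : 'I_n) :
  urow (add_row x r) (widen_ord (leqnSn n) k) = urow x k.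
Proof. exact: (@add_row_widen (widen_ord (leqnSn n) k)). Qed.

Lemma lrow_add_row (k : 'I_n) :
  lrow (add_row x r) (widen_ord (leqnSn n) k) = lrow x k.
Proof. exact: (@add_row_widen (lift ord0 k)). Qed.

Lemma urow_add_row_max : urow (add_row x r) ord_max = bottom_row x.
Proof. exact: (@add_row_widen ord_max). Qed.

Lemma lrow_add_row_max : lrow (add_row x r) ord_max = r.
Proof.
rewrite -[RHS]bottom_add_row /lrow /bottom_row; exact: row_irr.
Qed.

Lemma drop_add_row : drop_row (add_row x r) = x.
Proof. by apply/ffunP => k; rewrite ffunE add_row_widen. Qed.

End AddRow.

Lemma add_drop_row (n : nat) (x : gt_array n.+1) :
  add_row (drop_row x) (bottom_row x) = x.
Proof.
apply/ffunP; apply: ord_last_ind => [k|]; last exact: bottom_add_row.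
by rewrite add_row_widen ffunE.
Qed.

Lemma gt_pattern_add_row (n : nat) (x : gt_array n) (r : zvec n.+1) :
  gt_pattern (add_row x r) <-> gt_pattern x /\ interlace (bottom_row x) r.
Proof.
split=> [h|[hx hr]].
  split=> [i|]; last first.
    by have := h ord_max; rewrite urow_add_row_max lrow_add_row_max.
  by have := h (widen_ord (leqnSn n) i); rewrite urow_add_row lrow_add_row.
apply: ord_last_ind => [i|].
  by rewrite urow_add_row lrow_add_row; exact: hx.
by rewrite urow_add_row_max lrow_add_row_max.
Qed.

Lemma gt_pattern_bottom (n : nat) (x : gt_array n) :
  gt_pattern x -> weyl_chamber (bottom_row x).
Proof.
case: n x => [|n] x; first by move=> _ i; have := ltn_ord i; rewrite ltn0.
rewrite -{1}(add_drop_row x) => /gt_pattern_add_row[_ h] i j ij.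
have lin : (i < n)%N by have := ltn_ord j; rewrite ij.
have /andP[h1 h2] := h (Ordinal lin).
have -> : i = widen_ord (leqnSn n) (Ordinal lin) by apply: val_inj.
have -> : j = lift ord0 (Ordinal lin) by apply: val_inj.
exact: le_trans h1 h2.
Qed.

(** Makes Schur functions positive on the chamber. Deleting the last entry of [z] gives an
    admissible row above it, and induction fills in the rest. *)
Lemma gt_pattern_with_neq0 (n : nat) (z : zvec n) :
  weyl_chamber z -> gt_pattern_with z !=set0.
Proof.
elim: n z => [|n IH] z wz.
  exists [ffun k : 'I_1 => [ffun=> 0]]; split; first by move=> i; have := ltn_ord i; rewrite ltn0.
  by apply/ffunP => i; have := ltn_ord i; rewrite ltn0.
pose u : zvec n := [ffun j => z (widen_ord (leqnSn n) j)].
have [x [px bx]] : gt_pattern_with u !=set0.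
  apply: IH => i j ij; rewrite !ffunE; exact: wz.
exists (add_row x z); split; last exact: bottom_add_row.
apply/gt_pattern_add_row; split=> // j; rewrite bx ffunE lexx /=.
exact: wz.
Qed.

(** * Integer boxes and finiteness of the sets of patterns *)

Definition zbox (n : nat) (a b : 'I_n -> int) : set (zvec n) :=
  [set u | forall j, a j <= u j <= b j].

Definition shift_ffun (n M : nat) (a : 'I_n -> int) (m : {ffun 'I_n -> 'I_M}) :
  zvec n := [ffun j => a j + (m j)%:Z].

(** Codes a box by functions into one finite type, so that finite distributivity applies to sums
    over it. One bound [M] serves all sides, and empty sides are allowed. *)
Lemma zbox_bij (n M : nat) (a b : 'I_n -> int) :
  (forall j, b j - a j < M%:Z) ->
  set_bij [set m : {ffun 'I_n -> 'I_M} | [forall j, a j + (m j)%:Z <= b j]]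
    (zbox a b) (shift_ffun a).
Proof.
move=> hM; split.
- by move=> m /forallP h j; rewrite ffunE h lerDl.
- move=> m m' _ _ /ffunP e; apply/ffunP => j; have := e j.
  by rewrite !ffunE => /addrI[]/val_inj.
- move=> u hu.
  have lt j : (`|u j - a j| < M)%N by have := hM j; have := hu j; lia.
  exists [ffun j => Ordinal (lt j)].
    by apply/forallP => j; rewrite ffunE /=; have := hu j; lia.
  by apply/ffunP => j; rewrite !ffunE /=; have := hu j; lia.
Qed.

Lemma zbox_bound (n : nat) (a b : 'I_n -> int) :
  exists M : nat, forall j, b j - a j < M%:Z.
Proof.
exists (\max_j `|b j - a j|).+1 => j.
have := leq_bigmax (F := fun j => `|b j - a j|%N) j; lia.
Qed.

Lemma finite_zbox (n : nat) (a b : 'I_n -> int) : finite_set (zbox a b).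
Proof.
have [M hM] := zbox_bound a b.
have [_ _ s] := zbox_bij hM.
apply: sub_finite_set s _; apply: finite_image.
exact: finite_finset.
Qed.

Lemma finite_interlace (n : nat) (r : zvec n.+1) :
  finite_set [set u | interlace u r].
Proof.
exact: (finite_zbox (fun j => r (widen_ord (leqnSn n) j))
  (fun j => r (lift ord0 j))).
Qed.

Lemma finite_gt_pattern_with (n : nat) (z : zvec n) :
  finite_set (gt_pattern_with z).
Proof.
elim: n z => [|n IH] z.
  apply: (@sub_finite_set _ _ [set [ffun k : 'I_1 => [ffun=> 0]]]) => // x _.
  apply/ffunP => k; apply/ffunP => j; exfalso.
  by case: k j => -[|//] p j; have := ltn_ord j; rewrite ltn0.
have sub : gt_pattern_with z `<=`
    \bigcup_(u in [set u | interlace u z]) ((fun x => add_row x z) @` gt_pattern_with u).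
  move=> x [px bx]; exists (bottom_row (drop_row x)).
    by move: px; rewrite -{1}(add_drop_row x) bx => /gt_pattern_add_row[].
  exists (drop_row x); last by rewrite -bx add_drop_row.
  by split=> //; move: px; rewrite -{1}(add_drop_row x) => /gt_pattern_add_row[].
apply: sub_finite_set sub _.
apply: bigcup_finite; first exact: finite_interlace.
by move=> u _; exact: finite_image.
Qed.

(** * The law of one particle's jump and its telescoping sum *)

Section JumpProbabilities.
Variables (F : fieldType) (q : F).

(* Law of [y + xi], and of [Num.min (y + xi) u], for xi geometric. *)
Definition free_mass (y r : int) : F :=
  if y <= r then (1 - q) * q ^ (r - y) else 0.

Definition blocked_mass (y u r : int) : F :=
  if r < u then free_mass y r
  else if r == u then (if y <= r then q ^ (r - y) else 1) else 0.

Definition jump_prob (n : nat) (row : zvec n.+1) (up up' : zvec n)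
    (j : 'I_n.+1) (r : int) : F :=
  if unlift ord_max j is Some j' then blocked_mass (pushed row up' j) (up j') r
  else free_mass (pushed row up' j) r.

Hypothesis q0 : q != 0.

(* Since (1 - q) q^(-u) = q^(-u) - q^(-(u-1)), the sum over the blocking
   position u telescopes. *)
Lemma blocked_mass_partial_sum (a r : int) (N : nat) :
  \sum_(i < N) q ^ (- (a + i%:Z)) * blocked_mass a (a + i%:Z) r =
  if a <= r < a + N%:Z then q ^ (r - a - (a + N%:Z - 1)) else 0.
Proof.
elim: N => [|N IH].
  by rewrite big_ord0; case: ifP => //; lia.
rewrite big_ord_recr /= {}IH /blocked_mass /free_mass.
have [ar|ra] := leP a r; last first.
  rewrite /= add0r; case: ltP => _; first by rewrite mulr0.
  by case: eqP => [e|_]; [lia | rewrite mulr0].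
have [rN|Nr] := ltP r (a + N%:Z).
  rewrite ifT; last by lia.
  (* The partial sum so far is q^(E + 1) and the new term is (1 - q) q^E; together they give q^E. *)
  set E := r - a - (a + N.+1%:Z - 1).
  have -> : r - a - (a + N%:Z - 1) = E + 1 by rewrite /E; lia.
  rewrite mulrCA -(expfzDr _ _ q0) (expfzDr _ _ q0) expr1z.
  have -> : - (a + N%:Z) + (r - a) = E by rewrite /E; lia.
  rewrite /=; ring.
have [->|rN] := eqVneq r (a + N%:Z).
  rewrite ifT; last by lia.
  by rewrite add0r -expfzDr //; congr (q ^ _); lia.
rewrite mulr0 addr0 ifF //; lia.
Qed.

Lemma blocked_mass_sum (a b r : int) (M : nat) : b - a < M%:Z ->
  \sum_(i < M | a + i%:Z <= b) q ^ (- (a + i%:Z)) * blocked_mass a (a + i%:Z) r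
  = if a <= r <= b then q ^ (r - a - b) else 0.
Proof.
move=> bM; have [ab|ba] := leP a b; last first.
  rewrite big_pred0 => [|i]; first by case: ifP => //; lia.
  by apply/negbTE; lia.
have [N bN] : exists N : nat, b = a + N%:Z by exists `|b - a|%N; lia.
have NM : (N < M)%N by lia.
rewrite (eq_bigl (fun i : 'I_M => (i < N.+1)%N)); last by move=> i /=; lia.
rewrite -(big_ord_widen _
  (fun i : nat => q ^ (- (a + i%:Z)) * blocked_mass a (a + i%:Z) r) NM).
rewrite blocked_mass_partial_sum.
have -> : (a <= r < a + N.+1%:Z) = (a <= r <= b) by lia.
by case: ifP => // _; congr (q ^ _); lia.
Qed.

End JumpProbabilities.

(** * Summing one row of jumps over the row that blocks it *)

Lemma unlift_max_widen (n : nat) (j : 'I_n) :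
  unlift ord_max (widen_ord (leqnSn n) j) = Some j.
Proof.
have -> : widen_ord (leqnSn n) j = lift ord_max j.
  by apply: val_inj; exact: esym (lift_max j).
exact: liftK.
Qed.

(** A maximum is determined by its upper bounds; in this form the first particle, which nothing
    pushes, needs no separate case. *)
Lemma pushed_le (n : nat) (r : zvec n.+1) (v : zvec n) (k : 'I_n.+1) (m : int) :
  pushed r v k <= m <->
  r k <= m /\ (forall i : 'I_n, k = i.+1 :> nat -> v i <= m).
Proof.
rewrite /pushed; case: unliftP => [i ->|->].
  rewrite ge_max; split=> [/andP[-> vm]|[-> vm]] /=; last exact: vm.
  by split=> // i' /eq_add_S/val_inj<-.
by split=> [->|[]].
Qed.

Lemma precP (n : nat) (x x' : zvec n) :
  reflect ((forall i, x i <= x' i) /\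
           (forall i j : 'I_n, j = i.+1 :> nat -> x' i <= x j)) (prec x x').
Proof.
apply: (iffP andP) => -[h1 h2]; split.
- exact/forallP.
- move=> i j ij; have /forallP/(_ i)/forallP/(_ j)/implyP := h2.
  by apply; apply/eqP.
- exact/forallP.
- by apply/forallP => i; apply/forallP => j; apply/implyP => /eqP; exact: h2.
Qed.

Lemma zvec_size_pow (F : fieldType) (q : F) (n : nat) (f : 'I_n -> int) :
  q != 0 -> q ^ (\sum_i f i) = \prod_i q ^ f i.
Proof.
move=> q0; apply: (big_morph (fun i : int => q ^ i)) => // a b.
exact: expfzDr.
Qed.

(** The bound b_j on u_j; [row_floor] below is the bound a_j. *)
Definition row_ceiling (n : nat) (r : zvec n.+1) (v : zvec n) (j : 'I_n) : int :=
  Num.min (r (lift ord0 j)) (v j).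

Definition row_floor (n : nat) (r : zvec n.+1) (v : zvec n) (j : 'I_n) : int :=
  pushed r v (widen_ord (leqnSn n) j).

(** Interlacing gives r_j <= u_j <= r_(j+1), and [prec u v] gives v_(j-1) <= u_j <= v_j. No
    constraint links two entries of [u], which is why the sum over [u] factorizes. *)
Lemma zbox_interlace_prec (n : nat) (r : zvec n.+1) (v : zvec n) :
  [set u | interlace u r] `&` [set u | prec u v]
  = zbox (row_floor r v) (row_ceiling r v).
Proof.
apply/seteqP; split=> u /=.
  move=> [ur /precP[uv vu]] j; have /andP[r1 r2] := ur j.
  rewrite /row_ceiling le_min r2 uv !andbT.
  by apply/pushed_le; split=> // i ij; exact: vu.
move=> h; split=> [j|].
  have /andP[/pushed_le[-> _]] := h j.
  by rewrite le_min => /andP[].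
apply/precP; split=> [j|i j ij].
  by have /andP[_] := h j; rewrite le_min => /andP[].
by have /andP[/pushed_le[_ +] _] := h j; apply.
Qed.

(* Because max(r_(j+1), v_j) + min(r_(j+1), v_j) = r_(j+1) + v_j. *)
Lemma pushed_row_ceiling_size (n : nat) (r : zvec n.+1) (v : zvec n) :
  \sum_(j < n.+1) pushed r v j + \sum_(j < n) row_ceiling r v j
  = zvec_size r + zvec_size v.
Proof.
rewrite /zvec_size !big_ord_recl -!addrA -!big_split /=.
congr (_ + _); first by rewrite /pushed unlift_none.
apply: eq_bigr => j _; rewrite /pushed liftK /row_ceiling; lia.
Qed.

(** Each telescoped factor leaves the indicator of a_j <= s_j <= b_j, and the last particle that of
    its pushed position. This collects them into the indicator in the kernel; the missing
    inequalities come from the interlacing of [v] and [s]. *)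
Lemma prec_row_box (n : nat) (r s : zvec n.+1) (v : zvec n) :
  interlace v s ->
  prec r s =
  [forall j : 'I_n, row_floor r v j <= s (widen_ord (leqnSn n) j) <= row_ceiling r v j]
  && (pushed r v ord_max <= s ord_max).
Proof.
move=> vs; apply/precP/andP => [[rs sr]|[/forallP h hmax]].
  have p k : pushed r v k <= s k.
    apply/pushed_le; split=> // i ki; have /andP[_] := vs i.
    by congr (_ <= s _); apply: val_inj.
  split=> //; apply/forallP => j; rewrite p le_min sr //=.
  by have /andP[] := vs j.
split=> [|i j ij].
  apply: ord_last_ind => [k|]; last by have /pushed_le[] := hmax.
  by have /andP[/pushed_le[]] := h k.
have ilt : (i < n)%N by have := ltn_ord j; rewrite ij.
have /andP[_] := h (Ordinal ilt); rewrite le_min => /andP[+ _].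
by congr (s _ <= r _); apply: val_inj.
Qed.

Lemma zbox_sum_prod (F : fieldType) (n : nat) (a b : 'I_n -> int) (M : nat)
    (f : 'I_n -> int -> F) : (forall j, b j - a j < M%:Z) ->
  \sum_(u \in zbox a b) \prod_j f j (u j)
  = \prod_j \sum_(i < M | a j + i%:Z <= b j) f j (a j + i%:Z).
Proof.
move=> hM; rewrite (reindex_fsbig _ _ _ _ (zbox_bij hM)).
rewrite bigA_distr_big_dep.
pose Q := [pred m : {ffun 'I_n -> 'I_M} | [forall j, a j + (m j)%:Z <= b j]].
rewrite -(bigfs (P := Q) _ (index_enum_uniq {ffun 'I_n -> 'I_M})); last first.
  by move=> m _; rewrite mem_index_enum.
apply: eq_big => [m|m _]; first by apply/forallP/familyP => h j; have := h j.
by apply: eq_bigr => j _; rewrite ffunE.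
Qed.

(** The one-row identity behind the intertwining: each blocked particle gives a telescoping sum over
    its own u_j, and the last particle a factor free of [u]. *)
Lemma row_sum (F : fieldType) (q : F) (n : nat) (r s : zvec n.+1) (v : zvec n) :
  q != 0 -> interlace v s ->
  \sum_(u \in [set u | interlace u r])
    (prec u v)%:R * (q ^ (- zvec_size u) * \prod_j jump_prob q r u v j (s j))
  = (1 - q) * q ^ (zvec_size s - zvec_size r - zvec_size v) * (prec r s)%:R.
Proof.
move=> q0 vs.
transitivity (\sum_(u \in zbox (row_floor r v) (row_ceiling r v))
  (q ^ (- zvec_size u) * \prod_j jump_prob q r u v j (s j))).
  rewrite -zbox_interlace_prec fsbig_mkcondr.
  apply: eq_fsbigr => u _.
  have -> : (u \in [set u | prec u v]) = prec u v by rewrite mem_setE.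
  by case: prec; rewrite ?mul1r ?mul0r.
have [M hM] := zbox_bound (row_floor r v) (row_ceiling r v).
pose f (j : 'I_n) (m : int) := q ^ (- m) *
  blocked_mass q (row_floor r v j) m (s (widen_ord (leqnSn n) j)).
transitivity (\sum_(u \in zbox (row_floor r v) (row_ceiling r v))
  (\prod_j f j (u j)) * free_mass q (pushed r v ord_max) (s ord_max)).
  apply: eq_fsbigr => u _; rewrite big_ord_recr /= {2}/jump_prob unlift_none.
  rewrite mulrA; congr (_ * _).
  rewrite /zvec_size -sumrN zvec_size_pow // -big_split /=.
  by apply: eq_bigr => j _; rewrite /jump_prob unlift_max_widen.
rewrite -mulr_fsuml (zbox_sum_prod _ hM).
under eq_bigr => j _ do rewrite (blocked_mass_sum _ _ (hM j)) //.
rewrite (prec_row_box _ vs) /free_mass.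
case: (boolP [forall j, _]) => /= [/forallP h|].
  under eq_bigr => j _ do rewrite h.
  rewrite -zvec_size_pow //.
  case: leP => _; last by rewrite !mulr0.
  rewrite mulr1 mulrCA -expfzDr //; congr (_ * q ^ _).
  (* The total exponent is |s| minus all pushed positions and all ceilings, that is |s| - |r| -
     |v|. *)
  have := pushed_row_ceiling_size r v; rewrite big_ord_recr /= -/(row_floor _ _ _).
  rewrite [zvec_size s]/zvec_size big_ord_recr /= !sumrB /row_floor.
  move=> e; lra.
rewrite negb_forall => /existsP[j /negbTE hj].
by rewrite (bigD1 j) //= hj !mul0r mulr0.
Qed.

(** * The branching rule for patterns and the intertwining *)

Lemma fsum_fiber (V : nmodType) (I J : choiceType) (A : set I) (B : set J)
    (f : I -> J) (F : I -> V) :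
  finite_set A -> finite_set B -> (forall i, A i -> B (f i)) ->
  \sum_(i \in A) F i = \sum_(j \in B) \sum_(i \in A `&` [set i | f i = j]) F i.
Proof.
move=> Afin Bfin AB.
under [RHS]eq_fsbigr => j _ do rewrite fsbig_mkcondr.
rewrite exchange_fsbig //; apply: eq_fsbigr => i /[!inE] Ai.
rewrite (fsbigD1 (f i)) //=; last exact: AB.
rewrite ifT ?inE // fsbig1 ?addr0 // => j [_ /= ji].
by rewrite ifF //; apply/negP; rewrite inE /= => /esym.
Qed.

Lemma gt_pattern_with_add_row (n : nat) (u : zvec n) (z : zvec n.+1) :
  interlace u z ->
  set_bij (gt_pattern_with u)
    (gt_pattern_with z `&` [set x | bottom_row (drop_row x) = u])
    (fun x => add_row x z).
Proof.
move=> uz; split.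
- move=> x [px bx] /=; rewrite drop_add_row; split=> //.
  split; last exact: bottom_add_row.
  by apply/gt_pattern_add_row; rewrite bx.
- move=> x x' _ _ e; have := congr1 (@drop_row _) e.
  by rewrite !drop_add_row.
- move=> x [[px bx] /= dx]; exists (drop_row x); last by rewrite -bx add_drop_row.
  by split=> //; move: px; rewrite -{1}(add_drop_row x) => /gt_pattern_add_row[].
Qed.

(** The branching rule of Schur functions, for an arbitrary summand. *)
Lemma gt_pattern_with_sum (V : nmodType) (n : nat) (z : zvec n.+1)
    (F : gt_array n.+1 -> V) :
  \sum_(x \in gt_pattern_with z) F x =
  \sum_(u \in [set u | interlace u z])
    \sum_(x \in gt_pattern_with u) F (add_row x z).
Proof.
rewrite (fsum_fiber (f := fun x => bottom_row (drop_row x)) _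
  (finite_gt_pattern_with z) (finite_interlace z)); last first.
  move=> x [px bx] /=; move: px; rewrite -{1}(add_drop_row x) bx.
  by move=> /gt_pattern_add_row[].
apply: eq_fsbigr => u /[!inE] /= uz.
exact: (reindex_fsbig _ _ _ _ (gt_pattern_with_add_row uz)).
Qed.

(** The transition kernel Q. With [x] and [y] fixed, each entry of [y] constrains a single jump,
    hence the product. *)
Definition step_prob (R : realType) (n : nat) (q : 'I_n -> R)
    (x y : gt_array n) : R :=
  \prod_(k < n) \prod_(j < k.+1)
    jump_prob (q k) (lrow x k) (urow x k) (urow y k) j (lrow y k j).

Section Intertwining.
Variable R : realType.

Lemma gt_weight_add_row (n : nat) (q : 'I_n.+1 -> R) (x : gt_array n)
    (r : zvec n.+1) :
  gt_weight q (add_row x r) =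
  gt_weight (fun i => q (widen_ord (leqnSn n) i)) x
  * q ord_max ^ (zvec_size r - zvec_size (bottom_row x)).
Proof.
rewrite /gt_weight big_ord_recr /= lrow_add_row_max urow_add_row_max.
by congr (_ * _); apply: eq_bigr => i _; rewrite lrow_add_row urow_add_row.
Qed.

Lemma step_prob_add_row (n : nat) (q : 'I_n.+1 -> R) (x y : gt_array n)
    (r s : zvec n.+1) :
  step_prob q (add_row x r) (add_row y s) =
  step_prob (fun i => q (widen_ord (leqnSn n) i)) x y *
  \prod_j jump_prob (q ord_max) r (bottom_row x) (bottom_row y) j (s j).
Proof.
rewrite /step_prob big_ord_recr /= !lrow_add_row_max !urow_add_row_max.
by congr (_ * _); apply: eq_bigr => i _; rewrite !lrow_add_row !urow_add_row.
Qed.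

Lemma gt_array0_eq (x y : gt_array 0) : x = y.
Proof.
apply/ffunP => k; apply/ffunP => j; exfalso.
by case: k j => -[|//] p j; have := ltn_ord j; rewrite ltn0.
Qed.

(** The intertwining before normalization. For a fixed row [u] above [z], the induction hypothesis
    sums out everything above [u] and leaves the indicator of [prec u (bottom_row y)]; [row_sum]
    then sums over [u]. *)
Lemma intertwining (n : nat) (q : 'I_n -> R) (z : zvec n) (y : gt_array n) :
  (forall i, q i != 0) -> gt_pattern y ->
  \sum_(x \in gt_pattern_with z) gt_weight q x * step_prob q x y
  = \prod_(i < n) (1 - q i) * gt_weight q y * (prec z (bottom_row y))%:R.
Proof.
elim: n q z y => [|n IH] q z y q0 py.
  have -> : gt_pattern_with z = [set y].
    apply/seteqP; split=> x /=; first by move=> _; exact: gt_array0_eq.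
    move=> ->; split=> //; apply/ffunP => j.
    by have := ltn_ord j; rewrite ltn0.
  rewrite fsbig_set1 /gt_weight /step_prob !big_ord0.
  rewrite (_ : prec _ _ = true) ?mulr1 //.
  by apply/precP; split=> i; have := ltn_ord i; rewrite ltn0.
rewrite -(add_drop_row y) in py *.
move: (drop_row y) (bottom_row y) py => {}y s /gt_pattern_add_row[py ys].
rewrite gt_pattern_with_sum bottom_add_row gt_weight_add_row big_ord_recr /=.
set q' := fun i => q (widen_ord _ i); set qn := q ord_max.
set c := \prod_(i < n) _; have qn0 : qn != 0 by exact: q0.
transitivity (\sum_(u \in [set u | interlace u z])
  (c * gt_weight q' y * qn ^ zvec_size z) *
  ((prec u (bottom_row y))%:R * (qn ^ (- zvec_size u) *
     \prod_j jump_prob qn z u (bottom_row y) j (s j)))).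
  apply: eq_fsbigr => u _.
  transitivity (\sum_(x \in gt_pattern_with u)
     (gt_weight q' x * step_prob q' x y) *
     (qn ^ (zvec_size z - zvec_size u) *
       \prod_j jump_prob qn z u (bottom_row y) j (s j))).
    apply: eq_fsbigr => x /[!inE] -[_ bx].
    rewrite gt_weight_add_row step_prob_add_row bx.
    by rewrite -/qn -/q' mulrACA.
  rewrite -mulr_fsuml IH //; last by move=> i; exact: q0.
  rewrite expfzDr // -/c; ring.
rewrite -mulr_fsumr row_sum //.
(* The power qn^|z| pulled out of the weights cancels the qn^(-|z|) coming from [row_sum]; what is
   left is the weight of the last row of the new pattern. *)
have -> : zvec_size s - zvec_size z - zvec_size (bottom_row y) =
  - zvec_size z + (zvec_size s - zvec_size (bottom_row y)).
  by rewrite addrAC addrC.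
rewrite (expfzDr (- zvec_size z)) //.
have e : qn ^ zvec_size z * qn ^ (- zvec_size z) = 1.
  by rewrite -expfzDr // subrr.
rewrite -[RHS]mul1r -[X in _ = X * _]e; ring.
Qed.

(** * Positivity of Schur functions and the laws M_z *)

Section Schur.
Variables (n : nat) (q : 'I_n -> R).
Hypothesis q_gt0 : forall i, 0 < q i.

Lemma gt_weight_gt0 (x : gt_array n) : 0 < gt_weight q x.
Proof. by apply: prodr_gt0 => i _; rewrite exprz_gt0. Qed.

Lemma schur_ge0 (z : zvec n) : 0 <= schur q z.
Proof. by apply: fsumr_ge0 => x _; rewrite ltW // gt_weight_gt0. Qed.

Lemma schur_gt0 (z : zvec n) : weyl_chamber z -> 0 < schur q z.
Proof.
move=> /gt_pattern_with_neq0[x zx]; rewrite /schur (fsbigD1 x) //=; last first.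
  exact: finite_gt_pattern_with.
rewrite ltr_pwDl ?gt_weight_gt0 //.
by apply: fsumr_ge0 => y _; rewrite ltW // gt_weight_gt0.
Qed.

Lemma gt_lawE (z : zvec n) (x : gt_array n) : gt_pattern_with z x ->
  gt_law q z x = gt_weight q x / schur q z.
Proof. by move=> zx; rewrite /gt_law ifT // inE. Qed.

Lemma gt_law_eq0 (z : zvec n) (x : gt_array n) : ~ gt_pattern_with z x ->
  gt_law q z x = 0.
Proof. by move=> zx; rewrite /gt_law ifF //; apply/negP; rewrite inE. Qed.

Lemma gt_law_ge0 (z : zvec n) (x : gt_array n) : 0 <= gt_law q z x.
Proof.
rewrite /gt_law; case: ifP => // _.
by rewrite divr_ge0 ?schur_ge0 // ltW // gt_weight_gt0.
Qed.

Lemma gt_law_sum (z : zvec n) : weyl_chamber z ->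
  \sum_(x \in gt_pattern_with z) gt_law q z x = 1.
Proof.
move=> wz; under eq_fsbigr => x /[!inE] zx do rewrite (gt_lawE zx).
by rewrite -mulr_fsuml mulfV // gt_eqF // schur_gt0.
Qed.

(* M_z Q = p(z, .) M: one step started from M_z leads to the bottom row z'
   with probability p(z, z'), and the pattern above it is then M_z' distributed. *)
Lemma gt_law_step (z : zvec n) (y : gt_array n) : gt_pattern y ->
  \sum_(x \in gt_pattern_with z) gt_law q z x * step_prob q x y
  = schur_kernel q z (bottom_row y) * gt_law q (bottom_row y) y.
Proof.
move=> py; rewrite (@gt_lawE (bottom_row y) y) //.
transitivity (\sum_(x \in gt_pattern_with z)
   (schur q z)^-1 * (gt_weight q x * step_prob q x y)).
  by apply: eq_fsbigr => x /[!inE] zx; rewrite (gt_lawE zx) mulrAC mulrC.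
rewrite -mulr_fsumr intertwining // => [|i]; last by rewrite gt_eqF.
have : schur q (bottom_row y) != 0.
  by rewrite gt_eqF // schur_gt0 //; exact: gt_pattern_bottom.
by rewrite /schur_kernel => s0; move: (schur q z)^-1 => iz; field.
Qed.

End Schur.
End Intertwining.

(** * One step of the dynamics for given jumps *)

Definition gt_step (n : nat) (m : forall k : 'I_n, 'I_k.+1 -> nat)
    (x y : gt_array n) : Prop :=
  forall (k : 'I_n) (j : 'I_k.+1),
    lrow y k j = moved (lrow x k) (urow x k) (urow y k) j (m k j).

Lemma gt_step_add_row (n : nat) (m : forall k : 'I_n.+1, 'I_k.+1 -> nat)
    (x y : gt_array n) (r s : zvec n.+1) :
  gt_step m (add_row x r) (add_row y s) <->
  gt_step (fun k => m (widen_ord (leqnSn n) k)) x y /\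
  forall j, s j = moved r (bottom_row x) (bottom_row y) j (m ord_max j).
Proof.
split=> [h|[hxy hs]].
  split=> [k j|j]; last first.
    by have := h ord_max j; rewrite !lrow_add_row_max !urow_add_row_max.
  by have := h (widen_ord (leqnSn n) k) j; rewrite !lrow_add_row !urow_add_row.
apply: ord_last_ind => [k|] j.
  by rewrite !lrow_add_row !urow_add_row; exact: hxy.
by rewrite !lrow_add_row_max !urow_add_row_max.
Qed.

(** Row k of [y] is explicit once row k - 1 of [y] is known, so [y] is built from the top down;
    uniqueness follows by the same induction. *)
Lemma gt_step_exists (n : nat) (m : forall k : 'I_n, 'I_k.+1 -> nat)
    (x : gt_array n) : exists y, gt_step m x y.
Proof.
elim: n m x => [|n IH] m x.
  by exists x => k; have := ltn_ord k; rewrite ltn0.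
have [y hy] := IH (fun k => m (widen_ord (leqnSn n) k)) (drop_row x).
pose s : zvec n.+1 := [ffun j => moved (bottom_row x)
  (bottom_row (drop_row x)) (bottom_row y) j (m ord_max j)].
exists (add_row y s); rewrite -(add_drop_row x).
by apply/gt_step_add_row; split=> // j; rewrite ffunE.
Qed.

Lemma gt_step_unique (n : nat) (m : forall k : 'I_n, 'I_k.+1 -> nat)
    (x y y' : gt_array n) : gt_step m x y -> gt_step m x y' -> y = y'.
Proof.
elim: n m x y y' => [|n IH] m x y y'; first by move=> *; exact: gt_array0_eq.
rewrite -(add_drop_row x) -(add_drop_row y) -(add_drop_row y').
move=> /gt_step_add_row[h hs] /gt_step_add_row[h' hs'].
rewrite -(IH _ _ _ _ h h') in hs' *; congr add_row.
by apply/ffunP => j; rewrite hs hs'.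
Qed.

Lemma moved_interlace (n : nat) (r s : zvec n.+1) (u v : zvec n)
    (m : 'I_n.+1 -> nat) :
  interlace u r -> prec u v -> (forall j, s j = moved r u v j (m j)) ->
  interlace v s /\ prec r s.
Proof.
move=> ur /precP[uv vu] hs.
(* Blocking never undoes a push: both r_j and v_(j-1) are at most u_j, hence so is the pushed
   position. *)
have pushed_s j : pushed r v j <= s j.
  rewrite hs /moved; case: unliftP => [i ej|_]; last by rewrite lerDl.
  rewrite le_min lerDl /=; apply/pushed_le; split.
    have /andP[+ _] := ur i; congr (r _ <= _); apply: val_inj => /=.
    by rewrite ej lift_max.
  move=> i' ji'; apply: vu; rewrite -ji' ej; exact/esym/lift_max.
have s_u (j : 'I_n) : s (widen_ord (leqnSn n) j) <= u j.
  by rewrite hs /moved unlift_max_widen ge_min lexx orbT.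
split=> [j|].
  rewrite (le_trans (s_u j)) //=.
  by have /pushed_le[_] := pushed_s (lift ord0 j); apply.
apply/precP; split=> [i|i j ij]; first by have /pushed_le[] := pushed_s i.
have ilt : (i < n)%N by have := ltn_ord j; rewrite ij.
have -> : i = widen_ord (leqnSn n) (Ordinal ilt) by apply: val_inj.
apply: le_trans (s_u _) _; have /andP[_] := ur (Ordinal ilt).
by congr (_ <= r _); apply: val_inj.
Qed.

(** The relation [prec] is proved together with the pattern property because updating the next row
    needs it of the row above. *)
Lemma gt_step_pattern (n : nat) (m : forall k : 'I_n, 'I_k.+1 -> nat)
    (x y : gt_array n) : gt_pattern x -> gt_step m x y ->
  gt_pattern y /\ prec (bottom_row x) (bottom_row y).
Proof.
elim: n m x y => [|n IH] m x y.
  move=> _ _; split; first by move=> k; have := ltn_ord k; rewrite ltn0.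
  by apply/precP; split=> i; have := ltn_ord i; rewrite ltn0.
rewrite -(add_drop_row x) -(add_drop_row y) !bottom_add_row.
move=> /gt_pattern_add_row[px xr] /gt_step_add_row[h hs].
have [py xy] := IH _ _ _ px h; have [ys rs] := moved_interlace xr xy hs.
by split=> //; apply/gt_pattern_add_row.
Qed.

(** * Probabilities of events of a single geometric jump *)

Section Geometric.
Context {d : measure_display} {T : measurableType d} {R : realType}.
Variable P : probability T R.

Lemma sigma_rv_preimage (S : Type) (Y : T -> S) (B : set S) :
  sigma_rv Y (Y @^-1` B).
Proof. by exists B => //; rewrite setTI. Qed.

Lemma discrete_rv_preimage (S : Type) (Y : T -> S) (B : set S) :
  discrete_rv Y -> measurable (Y @^-1` B).
Proof. by apply; exact: sigma_rv_preimage. Qed.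

Variables (q : R) (Y : T -> nat).
Hypothesis q01 : 0 < q < 1.
Hypothesis mY : discrete_rv Y.
Hypothesis PY : forall m, P [set w | Y w = m] = ((1 - q) * q ^+ m)%:E.

(** The chance of reaching a blocking position. Removing one value at a time, P(Y > c) = P(Y >= c) -
    P(Y = c), avoids summing a series. *)
Lemma geometric_tail (c : nat) : P [set w | (c <= Y w)%N] = (q ^+ c)%:E.
Proof.
elim: c => [|c IH].
  by rewrite (_ : [set w | _] = setT) ?probability_setT //; apply/seteqP.
have mc (B : set nat) : measurable [set w | B (Y w)].
  exact: discrete_rv_preimage.
have e : [set w | (c <= Y w)%N] = [set w | Y w = c] `|` [set w | (c < Y w)%N].
  apply/seteqP; split=> w /=; last by case=> [->//|/ltnW].
  by rewrite leq_eqVlt => /orP[/eqP->|]; [left|right].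
have PU : P [set w | (c <= Y w)%N]
    = (P [set w | Y w = c] + P [set w | (c < Y w)%N])%E.
  rewrite e; apply: measureU.
  - exact: (mc [set k | k = c]).
  - exact: (mc [set k | (c < k)%N]).
  - by apply/seteqP; split=> w //= [->]; rewrite ltnn.
have fc : P [set w | (c < Y w)%N] \is a fin_num.
  by apply: fin_num_measure; exact: (mc [set k | (c < k)%N]).
move: PU; rewrite IH PY -(fineK fc) -EFinD => -[h].
by congr (_%:E); rewrite exprS; lra.
Qed.

Lemma free_mass_prob (y r : int) :
  P [set w | y + (Y w)%:Z = r] = (free_mass q y r)%:E.
Proof.
rewrite /free_mass; case: leP => yr; last first.
  rewrite (_ : [set w | _] = set0) ?measure0 //.
  by apply/seteqP; split=> w //= e; lia.
have e : r - y = `|r - y|%N%:Z by lia.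
rewrite {1}e -PY; congr (P _).
by apply/seteqP; split=> w /=; lia.
Qed.

Lemma blocked_mass_prob (y u r : int) :
  P [set w | Num.min (y + (Y w)%:Z) u = r] = (blocked_mass q y u r)%:E.
Proof.
rewrite /blocked_mass; case: ltP => ru.
  rewrite -free_mass_prob; congr (P _).
  by apply/seteqP; split=> w /=; lia.
case: eqVneq => [->|ne]; last first.
  rewrite (_ : [set w | _] = set0) ?measure0 //.
  by apply/seteqP; split=> w //= e; lia.
(* If the start [y] lies beyond [u], the minimum is [u] whatever the jump, hence mass 1. *)
case: leP => yu; last first.
  rewrite (_ : [set w | _] = setT) ?probability_setT //.
  by apply/seteqP; split=> w //= _; lia.
have e : u - y = `|u - y|%N%:Z by lia.
rewrite {1}e -geometric_tail; congr (P _).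
by apply/seteqP; split=> w /=; lia.
Qed.

Lemma jump_prob_moved (n : nat) (row : zvec n.+1) (up up' : zvec n)
    (j : 'I_n.+1) (r : int) :
  P [set w | moved row up up' j (Y w) = r]
  = (jump_prob q row up up' j r)%:E.
Proof.
rewrite /moved /jump_prob; case: unliftP => [j' _|_].
  exact: blocked_mass_prob.
exact: free_mass_prob.
Qed.

End Geometric.

(** Countable additivity transported along [pickle]; numbers that code no index get the empty
    set. *)
Lemma esum_measure_bigcup (d : measure_display) (T : measurableType d)
    (R : realType) (mu : {measure set T -> \bar R}) (I : countType) (D : set I)
    (E : I -> set T) :
  (forall i, measurable (E i)) -> trivIset D E ->
  (\esum_(i in D) mu (E i) = mu (\bigcup_(i in D) E i))%E.
Proof.
move=> mE tE.
pose G k := if choice.unpickle k is Some i then E i else set0.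
have Gp i : G (choice.pickle i) = E i by rewrite /G choice.pickleK.
have -> : \bigcup_(i in D) E i = \bigcup_(k in [set choice.pickle i | i in D]) G k.
  by rewrite bigcup_image; apply: eq_bigcupr => i _; rewrite Gp.
rewrite measure_bigcup.
- rewrite nneseries_esum // set_mem_set.
  rewrite (reindex_esum D _ choice.pickle); last first.
    by apply: inj_bij => i j _ _; exact: (pcan_inj choice.pickleK).
  by apply: eq_esum => i _; rewrite Gp.
- by move=> k _; rewrite /G; case: choice.unpickle.
- move=> _ _ [i Di <-] [j Dj <-]; rewrite !Gp => ij.
  by rewrite (tE i j).
Qed.

(** * Events independent of the inputs not yet used *)

Section Independence.
Context {d : measure_display} {T : measurableType d} {R : realType}.
Variables (P : probability T R) (I : choiceType) (F : I -> set (set T)).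
Hypothesis mF : forall i A, F i A -> measurable A.

Definition indep_of (K : set I) (H : set T) : Prop :=
  measurable H /\
  forall (J : {fset I}) (A : I -> set T),
    (forall i, i \in J -> K i /\ F i (A i)) ->
    P (H `&` \bigcap_(i in [set` J]) A i) = (P H * \prod_(i <- J) P (A i))%E.

Lemma indep_ofT : mutually_independent P F -> indep_of setT setT.
Proof.
move=> ind; split=> // J A JA.
rewrite setTI probability_setT mul1e; apply: ind => i iJ.
by have [] := JA i iJ.
Qed.

Lemma indep_ofS (K K' : set I) (H : set T) :
  K' `<=` K -> indep_of K H -> indep_of K' H.
Proof.
move=> KK [mH ind]; split=> // J A JA; apply: ind => i /JA[? ?].
by split=> //; exact: KK.
Qed.

Lemma indep_of0 (K : set I) : indep_of K set0.
Proof. by split=> // J A _; rewrite set0I measure0 mul0e. Qed.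

Lemma indep_ofI (K : set I) (H : set T) (i : I) (A : set T) :
  indep_of K H -> K i -> F i A ->
  indep_of (K `\ i) (H `&` A) /\ P (H `&` A) = (P H * P A)%E.
Proof.
move=> [mH ind] Ki FA.
have PHA : P (H `&` A) = (P H * P A)%E.
  have := ind [fset i]%fset (fun=> A).
  rewrite set_fset1 bigcap_set1 big_seq_fset1; apply=> j.
  by rewrite inE => /eqP->.
split=> //; split=> [|J B JB]; first by apply: measurableI => //; exact: mF FA.
have iJ : i \notin J by apply/negP => /JB[[_ ii] _]; exact: ii.
(* The family [B] extended by [A] at the index [i], which is not in [J]; the product formula for [H]
   over [J] and [i] together then gives the one for the enlarged past. *)
pose B' j := if j == i then A else B j.
have BB' j : j \in J -> B' j = B j.
  by rewrite /B'; case: eqP => // -> /(negP iJ).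
have B'i : B' i = A by rewrite /B' eqxx.
have := ind (i |` J)%fset B'.
rewrite big_fsetU1 //= B'i muleA -PHA.
rewrite (eq_big_seq (fun j => P (B j))) => [|j jJ]; last by rewrite BB'.
move=> <-; last first.
  move=> j; rewrite !inE => /orP[/eqP->|jJ]; first by rewrite B'i.
  by rewrite BB' //; have [[]] := JB j jJ.
congr (P _); apply/seteqP; split=> w.
  move=> [[Hw Aw] Bw]; split=> // j; rewrite /= !inE => /orP[/eqP->|jJ].
    by rewrite B'i.
  by rewrite BB' //; exact: Bw.
move=> [Hw Bw]; split; first split=> //.
  by have := Bw i; rewrite /B' eqxx; apply; rewrite /= !inE eqxx.
by move=> j /= jJ; rewrite -BB' //; apply: Bw; rewrite /= !inE jJ orbT.
Qed.

Lemma indep_of_bigcap (K : set I) (H : set T) (s : seq I) (A : I -> set T) :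
  uniq s -> (forall i, i \in s -> K i /\ F i (A i)) -> indep_of K H ->
  indep_of (K `\` [set` s]) (H `&` \bigcap_(i in [set` s]) A i) /\
  P (H `&` \bigcap_(i in [set` s]) A i) = (P H * \prod_(i <- s) P (A i))%E.
Proof.
elim: s => [|i s IH] /=.
  rewrite set_nil bigcap_set0 setIT big_nil mule1 => _ _ indH.
  by split=> //; apply: indep_ofS indH => i [].
move=> /andP[is_ us] sA indH.
have sA' j : j \in s -> K j /\ F j (A j).
  by move=> js; apply: sA; rewrite inE js orbT.
have [indH' PH'] := IH us sA' indH.
have [Ki Fi] := sA i (mem_head _ _).
have KDi : (K `\` [set` s]) i by split=> //=; exact/negP.
have [ind' P'] := indep_ofI indH' KDi Fi.
have -> : [set` i :: s] = i |` [set` s].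
  apply/seteqP; split=> j /=; rewrite inE.
    by move=> /orP[/eqP|]; [left|right].
  by move=> [->|->]; rewrite ?eqxx ?orbT.
rewrite bigcap_setU1 [A i `&` _]setIC setIA; split.
  by apply: indep_ofS ind' => j [Kj /not_orP[ji js]].
by rewrite P' PH' big_cons -muleA [X in (_ * X)%E]muleC.
Qed.

(** Over disjoint events both sides of the product formula are additive in [H]. This allows summing
    over the unobserved pattern. *)
Lemma indep_of_bigcup (U : choiceType) (K : set I) (D : set U)
    (G : U -> set T) :
  finite_set D -> trivIset D G -> (forall x, D x -> indep_of K (G x)) ->
  indep_of K (\bigcup_(x in D) G x).
Proof.
move=> Dfin tG indG.
have mG x : D x -> measurable (G x) by move=> /indG[].
split=> [|J A JA]; first exact: fin_bigcup_measurable.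
rewrite setI_bigcupl !measure_fin_bigcup //.
- rewrite ge0_mule_fsuml //; apply: eq_fsbigr => x /[!inE] Dx.
  by have [_] := indG x Dx; apply.
- by apply: trivIset_setIr.
- move=> x Dx; apply: measurableI; first exact: mG.
  by apply: fin_bigcap_measurable => // i /= iJ; have [_ /mF] := JA i iJ.
Qed.

End Independence.

(** * The random step and its transition probabilities *)

Section Dynamics.
Context {d : measure_display} {T : measurableType d} {R : realType}.
Variables (P : probability T R) (n : nat) (q : 'I_n -> R).
Variable xi : forall k : 'I_n, 'I_k.+1 -> nat -> T -> nat.
Arguments xi : clear implicits.
Variable X : nat -> T -> gt_array n.
Hypothesis q01 : forall i, 0 < q i < 1.
Hypothesis geom_xi : geometric_jumps P q xi.
Hypothesis mX0 : discrete_rv (X 0%N).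
Hypothesis ind_inputs : independent_inputs P (X 0%N) xi.

Local Notation input := (option (nat * {k : 'I_n & 'I_k.+1})).

(** The index [Some (t, _)] stands for a jump at time t + 1, used in the step from t to t + 1;
    [None] is the initial pattern. *)
Definition input_family (a : input) : set (set T) :=
  match a with
  | None => sigma_rv (X 0%N)
  | Some (t, existT k j) => sigma_rv (xi k j t.+1)
  end.

Local Notation indep := (indep_of P input_family).

Lemma input_family_measurable (a : input) (A : set T) :
  input_family a A -> measurable A.
Proof.
case: a => [[t [k j]]|] /=; last exact: mX0.
by have [+ _] := @geom_xi k j t.+1 0%N isT; apply.
Qed.

Definition step_event (x y : gt_array n) (t : nat) : set T :=
  [set w | gt_step (fun k j => xi k j t.+1 w) x y].

Definition jump_event (x y : gt_array n) (a : input) : set T :=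
  match a with
  | None => setT
  | Some (t, existT k j) => [set w | moved (lrow x k) (urow x k) (urow y k) j
      (xi k j t.+1 w) = lrow y k j]
  end.

Definition inputs_at (t : nat) : seq input :=
  [seq Some (t, a) | a <- index_enum {k : 'I_n & 'I_k.+1}].

Lemma step_event_bigcap (x y : gt_array n) (t : nat) :
  step_event x y t = \bigcap_(a in [set` inputs_at t]) jump_event x y a.
Proof.
apply/seteqP; split=> w.
  by move=> h _ /mapP[[k j] _ ->] /=; rewrite h.
move=> h k j; apply/esym; apply: (h (Some (t, existT _ k j))).
by apply/mapP; exists (existT _ k j); rewrite ?mem_index_enum.
Qed.

Lemma jump_event_prob (x y : gt_array n) (t : nat) (k : 'I_n) (j : 'I_k.+1) :
  P (jump_event x y (Some (t, existT _ k j))) =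
  (jump_prob (q k) (lrow x k) (urow x k) (urow y k) j (lrow y k j))%:E.
Proof.
have g m := @geom_xi k j t.+1 m isT.
apply: jump_prob_moved; first exact: q01.
  by have [] := g 0%N.
by move=> m; have [] := g m.
Qed.

Lemma inputs_at_prob (x y : gt_array n) (t : nat) :
  (\prod_(a <- inputs_at t) P (jump_event x y a) = (step_prob q x y)%:E)%E.
Proof.
rewrite big_map.
rewrite /step_prob sig_big_dep /=.
rewrite (big_morph EFin (@EFinM R) erefl).
by apply: eq_bigr => -[k j] _; rewrite jump_event_prob.
Qed.

Lemma step_event_indep (K : set input) (H : set T) (x y : gt_array n)
    (t : nat) :
  (forall a, K (Some (t, a))) -> indep K H ->
  indep (K `\` [set` inputs_at t]) (H `&` step_event x y t) /\
  P (H `&` step_event x y t) = (P H * (step_prob q x y)%:E)%E.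
Proof.
move=> Kt indH; rewrite step_event_bigcap -(inputs_at_prob x y t).
apply: indep_of_bigcap indH.
- exact: input_family_measurable.
- rewrite map_inj_uniq ?index_enum_uniq // => a b [] //.
- move=> _ /mapP[[k j] _ ->]; split; first exact: Kt.
  exact: (sigma_rv_preimage _ [set m | moved _ _ _ _ m = _]).
Qed.

Lemma step_event_measurable (x y : gt_array n) (t : nat) :
  measurable (step_event x y t) /\
  P (step_event x y t) = (step_prob q x y)%:E.
Proof.
have := @step_event_indep setT setT x y t (fun=> I) (indep_ofT _).
rewrite setTI probability_setT mul1e => /(_ ind_inputs)[[+ _] +].
by [].
Qed.

Lemma step_prob_ge0 (x y : gt_array n) : 0 <= step_prob q x y.
Proof.
by rewrite -lee_fin -(step_event_measurable x y 0).2.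
Qed.

(** Every outcome of the jumps leads from [x] to exactly one array, and it is a pattern, so the step
    events partition the space. The factor [c] is carried by the scaled measure and need not be
    pulled out of an infinite sum. *)
Lemma step_prob_sum (x : gt_array n) (c : {nonneg R}) : gt_pattern x ->
  (\esum_(y in @gt_pattern n) (c%:num * step_prob q x y)%:E = c%:num%:E)%E.
Proof.
move=> px.
transitivity (\esum_(y in @gt_pattern n) mscale c P (step_event x y 0))%E.
  apply: eq_esum => y _; rewrite EFinM.
  by rewrite -(step_event_measurable x y 0).2.
rewrite esum_measure_bigcup.
- rewrite (_ : \bigcup_(y in _) _ = setT).
    by rewrite -[RHS]mule1 -(probability_setT P).
  apply/seteqP; split=> // w _.
  have [y xy] := gt_step_exists (fun k j => xi k j 1%N w) x.
  by exists y => //; have [] := gt_step_pattern px xy.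
- by move=> y; have [] := step_event_measurable x y 0.
- by move=> y y' _ _ [w [xy xy']]; exact: gt_step_unique xy xy'.
Qed.

Let q_gt0 i : 0 < q i. Proof. by have /andP[] := q01 i. Qed.

Lemma schur_kernel_ge0 (x y : zvec n) : 0 <= schur_kernel q x y.
Proof.
rewrite /schur_kernel !mulr_ge0 ?invr_ge0 ?schur_ge0 ?ler0n //.
by apply: prodr_ge0 => i _; rewrite subr_ge0 ltW //; have /andP[] := q01 i.
Qed.

(** Spreading p(x, y) over the patterns above [y] by M_y turns the total mass into a sum over all
    patterns. There the intertwining replaces p M by M_x Q, and exchanging sums leaves the masses of
    Q and M_x, both 1. *)
Lemma schur_kernel_stochastic :
  stochastic_kernel (@weyl_chamber n) (schur_kernel q).
Proof.
split=> [x y _ _|x wx]; first exact: schur_kernel_ge0.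
transitivity (\esum_(y in @weyl_chamber n) \esum_(Y in gt_pattern_with y)
    (schur_kernel q x y * gt_law q y Y)%:E)%E.
  apply: eq_esum => y wy.
  rewrite esum_fset; last first.
  - by move=> Y _; rewrite lee_fin mulr_ge0 ?schur_kernel_ge0 ?gt_law_ge0.
  - exact: finite_gt_pattern_with.
  rewrite fsumEFin; last exact: finite_gt_pattern_with.
  by rewrite -mulr_fsumr gt_law_sum // mulr1.
rewrite esum_esum; last first.
  by move=> y Y _ _; rewrite lee_fin mulr_ge0 ?schur_kernel_ge0 ?gt_law_ge0.
rewrite (reindex_esum (@gt_pattern n) _ (fun Y => (bottom_row Y, Y))); last first.
  split.
  - by move=> Y pY; split=> //=; exact: gt_pattern_bottom.
  - by move=> Y Y' _ _ [].
  - by move=> [y Y] [wy [pY /= bY]]; exists Y => //; rewrite bY.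
transitivity (\esum_(Y in @gt_pattern n)
    (\sum_(z <- fset_set (gt_pattern_with x))
        (gt_law q x z * step_prob q z Y)%:E))%E.
  apply: eq_esum => Y pY /=.
  rewrite -gt_law_step // sumEFin fsbig_finite //.
  exact: finite_gt_pattern_with.
(* The repeated membership condition records that [z] is a pattern, as the total mass of Q
   requires. *)
rewrite (eq_esum (b := fun Y => (\sum_(z <- fset_set (gt_pattern_with x) |
   z \in gt_pattern_with x) (gt_law q x z * step_prob q z Y)%:E)%E)); last first.
  move=> Y _; rewrite big_seq; apply: eq_bigl => z.
  by rewrite in_fset_set //; exact: finite_gt_pattern_with.
rewrite esum_sum; last first.
  by move=> Y z _ _; rewrite lee_fin mulr_ge0 ?gt_law_ge0 ?step_prob_ge0.
rewrite (eq_bigr (fun z => (gt_law q x z)%:E)); last first.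
  move=> z; rewrite inE => -[pz _].
  exact: (step_prob_sum (NngNum (gt_law_ge0 q_gt0 x z)) pz).
rewrite (eq_bigl (fun z => z \in fset_set (gt_pattern_with x))); last first.
  by move=> z; rewrite in_fset_set //; exact: finite_gt_pattern_with.
rewrite -big_seq sumEFin -fsbig_finite; last exact: finite_gt_pattern_with.
by rewrite gt_law_sum.
Qed.

(** * The joint law of the history of bottom rows and the current pattern *)

Variable z : zvec n.
Hypothesis pattern_X : forall t w, gt_pattern (X t w).
Hypothesis dyn_X : gt_dynamics xi X.
Hypothesis law_X0 : forall x, P [set w | X 0%N w = x] = (gt_law q z x)%:E.

Definition future (t : nat) : set input :=
  [set a | if a is Some (s, _) then (t <= s)%N else False].

Definition history (t : nat) (h : nat -> zvec n) : set T :=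
  [set w | forall s, (s <= t)%N -> bottom_row (X s w) = h s].

(** The probability of the path [h] for a chain with kernel p started at [z]. *)
Fixpoint path_weight (t : nat) (h : nat -> zvec n) : R :=
  if t is t'.+1 then path_weight t' h * schur_kernel q (h t') (h t)
  else (h 0%N == z)%:R.

Lemma path_step (t : nat) (w : T) :
  gt_step (fun k j => xi k j t.+1 w) (X t w) (X t.+1 w).
Proof. by move=> k j; exact: dyn_X. Qed.

(** Splits according to the unobserved pattern at time t; equality holds because a step is
    determined by its jumps. *)
Lemma history_succ (t : nat) (h : nat -> zvec n) (y : gt_array n) :
  bottom_row y = h t.+1 ->
  history t.+1 h `&` [set w | X t.+1 w = y] =
  \bigcup_(x in gt_pattern_with (h t))
    ((history t h `&` [set w | X t w = x]) `&` step_event x y t).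
Proof.
move=> yh; apply/seteqP; split=> w.
  move=> [hw /= Xy]; exists (X t w); first by split=> //; exact: hw.
  split; first by split=> // s st; apply: hw; rewrite (leq_trans st).
  by rewrite /step_event /= -Xy; exact: path_step.
move=> [x [_ _]] [[hw /= Xx] xy].
have Xy : X t.+1 w = y.
  by apply: (gt_step_unique _ xy); rewrite -Xx; exact: path_step.
split=> // s; rewrite leq_eqVlt => /orP[/eqP->|]; first by rewrite Xy.
by rewrite ltnS; exact: hw.
Qed.

(** Whatever the past bottom rows, the current pattern has law M of the current one. Independence of
    later jumps is part of the induction, since the next step multiplies probabilities by it. *)
Lemma history_law (t : nat) (h : nat -> zvec n) (y : gt_array n) :
  indep (future t) (history t h `&` [set w | X t w = y]) /\
  P (history t h `&` [set w | X t w = y])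
  = (path_weight t h * gt_law q (h t) y)%:E.
Proof.
elim: t y => [|t IH] y.
  have -> : history 0 h `&` [set w | X 0%N w = y]
      = setT `&` X 0%N @^-1` [set x | x = y /\ bottom_row x = h 0%N].
    rewrite setTI; apply/seteqP; split=> w /=.
      by move=> [/(_ 0%N (leqnn _)) hw Xy].
    by move=> [Xy hw]; split=> // -[|].
  have [ind PX] := indep_ofI input_family_measurable
    (indep_ofT ind_inputs) (I : [set: input] None)
    (sigma_rv_preimage (X 0%N) [set x | x = y /\ bottom_row x = h 0%N]).
  split; first by apply: indep_ofS ind => -[a|].
  rewrite setTI /=.
  have [yh|yh] := eqVneq (bottom_row y) (h 0%N); last first.
    rewrite gt_law_eq0 => [|[_ /eqP]]; last by rewrite (negbTE yh).
    rewrite mulr0 (_ : _ @^-1` _ = set0) ?measure0 //.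
    by apply/seteqP; split=> w //= [-> /eqP]; rewrite (negbTE yh).
  rewrite (_ : _ @^-1` _ = [set w | X 0%N w = y]); last first.
    by apply/seteqP; split=> w /=; [case|move=> ->].
  rewrite law_X0; case: eqVneq => [->|hz]; first by rewrite mul1r.
  rewrite mul0r gt_law_eq0 // => -[_ /eqP].
  by rewrite yh (negbTE hz).
(* Outside the patterns with bottom row h(t + 1) the event is empty and the law vanishes. *)
have [[py yh]|] := pselect (gt_pattern_with (h t.+1) y); last first.
  move=> ny; rewrite gt_law_eq0 // mulr0.
  rewrite (_ : _ `&` _ = set0).
    by split; [exact: indep_of0 | rewrite measure0].
  apply/seteqP; split=> w //= [hw Xy]; apply: ny.
  by rewrite -Xy; split=> //; exact: hw.
rewrite history_succ //.
pose E x := (history t h `&` [set w | X t w = x]) `&` step_event x y t.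
rewrite -/E.
have tE : trivIset (gt_pattern_with (h t)) E.
  by move=> x x' _ _ [w [[[_ <-] _] [[_ <-] _]]].
have indE x := @step_event_indep (future t) _ x y t (fun=> leqnn t) (IH x).1.
split.
  (* The step has used the inputs of index t; those of index at least t + 1 remain. *)
  apply: (indep_ofS (K := future t `\` [set` inputs_at t])).
    move=> [[s a]|//] /= ts; split; first exact: ltnW.
    by move=> /mapP[b _ [st _]]; move: ts; rewrite st ltnn.
  apply: indep_of_bigcup => //.
  - exact: input_family_measurable.
  - exact: finite_gt_pattern_with.
  - by move=> x _; exact: (indE x).1.
rewrite measure_fin_bigcup //; last first.
- by move=> x _; have [[]] := indE x.
- exact: finite_gt_pattern_with.
(* The intertwining: one step from M of h(t) produces the next kernel factor times M of h(t + 1). *)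
rewrite /= -mulrA -yh -gt_law_step // mulr_fsumr -fsumEFin; last first.
  exact: finite_gt_pattern_with.
apply: eq_fsbigr => x _.
by rewrite /E (indE x).2 (IH x).2 -EFinM mulrA.
Qed.

Lemma history_prob (t : nat) (h : nat -> zvec n) :
  weyl_chamber (h t) -> P (history t h) = (path_weight t h)%:E.
Proof.
move=> wh.
have -> : history t h = \bigcup_(x in gt_pattern_with (h t))
    (history t h `&` [set w | X t w = x]).
  apply/seteqP; split=> w; last by case=> x _ [].
  by move=> hw; exists (X t w) => //; split=> //; exact: hw.
rewrite measure_fin_bigcup //.
- rewrite (eq_fsbigr (fun x => (path_weight t h * gt_law q (h t) x)%:E)); last first.
    by move=> x _; exact: (history_law t h x).2.
  rewrite fsumEFin; last exact: finite_gt_pattern_with.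
  by rewrite -mulr_fsumr gt_law_sum // mulr1.
- exact: finite_gt_pattern_with.
- by move=> x x' _ _ [w [[_ <-] [_ <-]]].
- by move=> x _; have [[]] := history_law t h x.
Qed.

(** Measurability is given only for the initial pattern and the jumps. As there are countably many
    arrays, an event at time t + 1 is a countable union over the pairs of consecutive arrays. *)
Lemma path_measurable (t : nat) (B : set (gt_array n)) :
  measurable (X t @^-1` B).
Proof.
elim: t B => [|t IH] B; first exact: discrete_rv_preimage.
have -> : X t.+1 @^-1` B = \bigcup_(x in setT) \bigcup_(y in B)
    (X t @^-1` [set x] `&` step_event x y t).
  apply/seteqP; split=> w.
    move=> Bw; exists (X t w) => //; exists (X t.+1 w) => //.
    by split; [rewrite /preimage /= | exact: (path_step t w)].
  move=> [x _ [y By [/= Xx xy]]]; rewrite /preimage /=.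
  suff -> : X t.+1 w = y by [].
  by apply: (gt_step_unique _ xy); rewrite -Xx; exact: path_step.
have mU (D : set (gt_array n)) (E : gt_array n -> set T) :
    (forall x, measurable (E x)) -> measurable (\bigcup_(x in D) E x).
  move=> mE; rewrite bigcup_mkcond; apply: countable_bigcupT_measurable.
    exact: countableP.
  by move=> x; case: ifP.
apply: (mU) => x; apply: (mU) => y; apply: measurableI; first exact: IH.
by have [] := step_event_measurable x y t.
Qed.

Lemma eq_path_weight (t : nat) (h h' : nat -> zvec n) :
  (forall s, (s <= t)%N -> h s = h' s) -> path_weight t h = path_weight t h'.
Proof.
elim: t => [|t IH] hh /=; first by rewrite hh.
by rewrite IH ?hh // => s st; rewrite hh // leqW.
Qed.

Lemma bottom_row_markov : weyl_chamber z ->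
  markov_chain P (@weyl_chamber n) z (schur_kernel q)
    (fun t w => bottom_row (X t w)).
Proof.
move=> wz; split.
- exact: schur_kernel_stochastic.
- move=> t _ [B _ <-]; rewrite setTI.
  exact: (path_measurable t (@bottom_row n @^-1` B)).
- by move=> t w; exact: gt_pattern_bottom.
- have := @history_prob 0%N (fun=> z) wz; rewrite /= eqxx => <-.
  congr (P _); apply/seteqP; split=> w /=; first by move=> Xz [].
  exact.
- move=> t h y wh wy.
  (* The path [h] continued by [y] at time t + 1, so that both probabilities are path weights
     differing by one kernel factor. *)
  pose h' s := if (s <= t)%N then h s else y.
  have hh' s : (s <= t)%N -> h s = h' s by rewrite /h' => ->.
  have yh' : h' t.+1 = y by rewrite /h' ltnn.
  have -> : [set w | (forall s, (s <= t)%N -> bottom_row (X s w) = h s) /\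
      bottom_row (X t.+1 w) = y] = history t.+1 h'.
    apply/seteqP; split=> w /=.
      move=> [hw Xy] s; rewrite leq_eqVlt => /orP[/eqP->|st].
        by rewrite yh'.
      by rewrite -hh' // hw.
    move=> hw; split=> [s st|]; last by rewrite hw.
    by rewrite hh' // hw // leqW.
  rewrite (@history_prob t.+1 h') ?yh' // (@history_prob t h); last exact: wh.
  rewrite /=.
  by rewrite -EFinM -hh' // yh' (@eq_path_weight t h h').
Qed.

End Dynamics.

Theorem theorem2p2 (R : realType) (d : measure_display) (T : measurableType d)
    (P : probability T R) (n : nat) (q : 'I_n -> R) (z : zvec n)
    (xi : forall k : 'I_n, 'I_k.+1 -> nat -> T -> nat)
    (X : nat -> T -> gt_array n) :
  (1 <= n)%N ->
  (forall i, 0 < q i < 1) ->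
  weyl_chamber z ->
  geometric_jumps P q xi ->
  discrete_rv (X 0%N) ->
  independent_inputs P (X 0%N) xi ->
  (forall t w, gt_pattern (X t w)) ->
  gt_dynamics xi X ->
  (forall x, P [set w | X 0%N w = x] = (gt_law q z x)%:E) ->
  markov_chain P (@weyl_chamber n) z (schur_kernel q)
    (fun t w => bottom_row (X t w)).
Proof.
move=> _ q01 wz geom_xi mX0 ind_inputs pattern_X dyn_X law_X0.
exact: (bottom_row_markov (xi := xi)).
Qed.
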